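(* Let $0<\phi_0<\phi_1<\frac{\pi}{2}$ and let $T_*:=T(\phi_1)+T_1(\phi_1,\phi_0)$. Then for each $L\in\left(0,\tfrac12 T_*\right)$ there is exactly one solution $(x,y):[-L,L]\to[-\frac{\pi}{2},\frac{\pi}{2}]\times\mathbb{R}$ of $$x'=y,\qquad y'=-\sin 2x,\qquad x(-L)=-\phi_0,\quad x(L)=\phi_1,$$ such that $y(t)>0$ for all $t\in[-L,L]$.
   Context: For $\alpha\in(0,\frac{\pi}{2})$ define $T(\alpha):=\int_0^{\alpha}\frac{dx}{\sqrt{\cos 2x-\cos 2\alpha}}$, and for $0<\phi\le\alpha$ define $T_1(\alpha,\phi):=\int_0^{\phi}\frac{dx}{\sqrt{\cos 2x-\cos 2\alpha}}$ (these are convergent, possibly improper, integrals; $T_1(\alpha,\alpha)=T(\alpha)$). *)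

(* Defs.v *)
From Stdlib Require Import Reals.
From Coquelicot Require Import Coquelicot.
Open Scope R_scope.

(* The integral is taken over [0, b] with b -> phi from the left, so that the
   singularity of the integrand at x = alpha is covered when phi = alpha. *)
Definition T1 (alpha phi : R) : R :=
  RInt_gen (fun x => / sqrt (cos (2 * x) - cos (2 * alpha)))
           (at_point 0) (at_left phi).

Definition T (alpha : R) : R := T1 alpha alpha.

(* A function on [-L, L] is represented by a total function whose values
   outside [-L, L] are irrelevant; [D_in] is the derivative relative to
   [-L, L], hence one-sided at the endpoints. *)
Definition is_solution (phi0 phi1 L : R) (x y : R -> R) : Prop :=
  let I := fun t => - L <= t <= L in
  (forall t, I t -> - (PI / 2) <= x t <= PI / 2) /\
  (forall t, I t -> D_in x y I t) /\
  (forall t, I t -> D_in y (fun s => - sin (2 * x s)) I t) /\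
  x (- L) = - phi0 /\
  x L = phi1.

Definition is_positive_solution (phi0 phi1 L : R) (x y : R -> R) : Prop :=
  is_solution phi0 phi1 L x y /\ (forall t, - L <= t <= L -> 0 < y t).

(* Main.v *)
Require Import Defs.
From Stdlib Require Import Reals Lra.
From Coquelicot Require Import Coquelicot.
Open Scope R_scope.

(** The system is conservative: along a solution y^2 - cos 2x is constant, and
since x(L) = phi1, a positive solution satisfies
  x' = y = sqrt (e + cos 2x - cos 2 phi1),   e = y(L)^2 > 0,
while x increases from -phi0 to phi1.  Separating variables, the time spent
between -phi0 and phi1 is the integral of 1 / sqrt (e + cos 2s - cos 2 phi1),
and this has to equal 2L.  So everything reduces to the transit time tau(e) as a
function of the energy e.

It is strictly decreasing ([transit_decreasing]), which makes e unique; then x is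
determined as the inverse function of the transit time measured from -phi0
([solution_transit], [transit_inj]), and y by the energy relation
([positive_solution_energy]).  Conversely, inverting the transit time always
produces a solution ([transit_inverse_solves]), so only tau(e) = 2L has to be
solvable.  The function tau is locally Lipschitz, takes values as small as
desired for large e, and hence reaches every positive value below one of its values
([transit_onto]).

That tau exceeds 2L for small e is where the hypothesis on L enters
([transit_exceeds]).  At e = 0 the integral up to b < phi1 increases, as b tends to
phi1, to T(phi1) + T1(phi1, phi0), because the integrand is even; hence some b
already gives more than 2L, and for this b the integrand has no singularity, so
that a small e > 0 still gives more than 2L.  The convergence of the improper
integrals comes from monotonicity: if the integrals up to b were all at most M, they
would converge to a value at most M, against the hypothesis on L
([RInt_gen_at_left_le]).

The difference cos 2s - cos 2 phi1 is replaced by its positive part [gap], which is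
nonnegative everywhere and agrees with it on the range of the solutions; the
transit time is then continuously differentiable on the whole line, and its
theory can be developed for an arbitrary continuous nonnegative [w]. *)

(** * Derivatives relative to a closed interval *)

Definition clamp (a b t : R) : R := Rmax a (Rmin b t).

Lemma clamp_in (a b t : R) : a <= b -> a <= clamp a b t <= b.
Proof.
  intros hab; unfold clamp, Rmax, Rmin.
  destruct (Rle_dec b t); repeat destruct (Rle_dec a _); lra.
Qed.

Lemma clamp_id (a b t : R) : a <= t <= b -> clamp a b t = t.
Proof.
  intros ht; unfold clamp, Rmax, Rmin.
  destruct (Rle_dec b t); repeat destruct (Rle_dec a _); lra.
Qed.

Lemma clamp_lipschitz (a b s t : R) :
  Rabs (clamp a b s - clamp a b t) <= Rabs (s - t).
Proof.
  unfold clamp, Rmax, Rmin.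
  repeat destruct (Rle_dec b _);
    repeat destruct (Rle_dec a _);
    unfold Rabs; repeat destruct (Rcase_abs _); lra.
Qed.

(** At an endpoint [D_in] is a one-sided derivative and says nothing about [f]
outside the interval; composing [f] with the projection onto the interval gives a
function that is continuous everywhere, to which the usual theorem applies. *)
Lemma D_in_MVT (f df : R -> R) (a b s t : R) :
  (forall r, a <= r <= b -> D_in f df (fun r => a <= r <= b) r) ->
  a <= s -> s <= t -> t <= b ->
  exists xi, s <= xi <= t /\ f t - f s = df xi * (t - s).
Proof.
  intros hf has hst htb.
  assert (hab : a <= b) by lra.
  destruct (MVT_gen (fun r => f (clamp a b r)) s t df) as [xi [hxi heq]].
  - rewrite Rmin_left, Rmax_right by lra.
    intros x hx.
    apply is_derive_Reals; intros eps heps.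
    destruct (hf x ltac:(lra) eps heps) as [alp [halp hlim]].
    assert (hd : 0 < Rmin alp (Rmin (x - s) (t - x)))
      by (repeat apply Rmin_pos; lra).
    exists (mkposreal _ hd); simpl; intros h h0 hh.
    pose proof (Rmin_l alp (Rmin (x - s) (t - x))).
    pose proof (Rmin_r alp (Rmin (x - s) (t - x))).
    pose proof (Rmin_l (x - s) (t - x)).
    pose proof (Rmin_r (x - s) (t - x)).
    assert (hh' := hh).
    apply Rabs_def2 in hh'.
    rewrite !clamp_id by lra.
    specialize (hlim (x + h)).
    unfold dist in hlim; simpl in hlim; unfold R_dist, D_x in hlim.
    replace (x + h - x) with h in hlim by ring.
    apply hlim.
    repeat split; lra.
  - intros x _ eps heps.
    pose proof (clamp_in a b x hab) as hc.
    destruct (cont_deriv _ _ _ _ (hf _ hc) eps heps) as [alp [halp hlim]].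
    exists alp; split; [exact halp|].
    intros y [_ hy]; simpl in *; unfold R_dist in *.
    destruct (Req_dec (clamp a b y) (clamp a b x)) as [->|hne].
    + rewrite Rminus_diag, Rabs_R0; exact heps.
    + apply hlim; split.
      * split; [apply clamp_in; exact hab | congruence].
      * pose proof (clamp_lipschitz a b y x); lra.
  - rewrite Rmin_left, Rmax_right in hxi by lra.
    rewrite !clamp_id in heq by lra.
    exists xi; split; assumption.
Qed.

(** * Improper integrals of nonnegative functions *)

(** A nondecreasing bounded function of [b] has a limit from the left, so the bound
on the proper integrals by itself makes the improper integral converge. *)
Lemma RInt_gen_at_left_le (f : R -> R) (phi M : R) :
  0 < phi ->
  (forall x, 0 <= x < phi -> continuous f x) ->
  (forall x, 0 <= x < phi -> 0 <= f x) ->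
  (forall b, 0 <= b < phi -> RInt f 0 b <= M) ->
  RInt_gen f (at_point 0) (at_left phi) <= M.
Proof.
  intros hphi hc hpos hM.
  assert (hex : forall a b, 0 <= a <= b -> b < phi -> ex_RInt f a b).
  { intros a b hab hb; apply (ex_RInt_continuous f); intros z.
    rewrite Rmin_left, Rmax_right by lra; intros hz; apply hc; lra. }
  destruct (completeness (fun y => exists b, 0 <= b < phi /\ y = RInt f 0 b))
    as [l [hub hlub]].
  { exists M; intros y [b [hb ->]]; apply hM; exact hb. }
  { exists (RInt f 0 0), 0; split; [lra | reflexivity]. }
  assert (hlM : l <= M).
  { apply hlub; intros y [b [hb ->]]; apply hM; exact hb. }
  replace (RInt_gen f (at_point 0) (at_left phi)) with l; [exact hlM|].
  symmetry; apply (is_RInt_gen_unique f l).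
  intros P [eps hP].
  assert (hb0 : exists b0, 0 <= b0 < phi /\ l - eps < RInt f 0 b0).
  { destruct (Classical_Prop.classic
      (exists b0, 0 <= b0 < phi /\ l - eps < RInt f 0 b0)) as [h|h]; [exact h|].
    exfalso.
    assert (l <= l - eps).
    { apply hlub; intros y [b [hb ->]].
      apply Rnot_lt_le; intros hlt; apply h; exists b; split; assumption. }
    pose proof (cond_pos eps); lra. }
  destruct hb0 as [b0 [hb0 hgt]].
  apply (Filter_prod _ _ _ (fun a => a = 0) (fun b => b0 < b < phi)).
  - reflexivity.
  - assert (hd : 0 < phi - b0) by lra.
    exists (mkposreal _ hd); intros y hy hlt.
    unfold ball in hy; simpl in hy; unfold AbsRing_ball, abs, minus, plus, opp in hy;
      simpl in hy.
    apply Rabs_def2 in hy; lra.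
  - intros a b -> hb; simpl.
    exists (RInt f 0 b); split.
    + apply (RInt_correct f), hex; lra.
    + apply hP.
      unfold ball; simpl; unfold AbsRing_ball, abs, minus, plus, opp; simpl.
      assert (hle : RInt f 0 b <= l) by (apply hub; exists b; split; [lra|reflexivity]).
      assert (hch : RInt f 0 b0 + RInt f b0 b = RInt f 0 b)
        by (apply (RInt_Chasles f); apply hex; lra).
      assert (0 <= RInt f b0 b).
      { apply RInt_ge_0; [lra | apply hex; lra | intros x hx; apply hpos; lra]. }
      apply Rabs_def1; lra.
Qed.

(** * Transit times *)

Definition speed (w : R -> R) (e s : R) : R := sqrt (e + w s).

Definition transit (w : R -> R) (e a b : R) : R :=
  RInt (fun s => / speed w e s) a b.

Lemma speed_pos (w : R -> R) (e s : R) : 0 < e + w s -> 0 < speed w e s.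
Proof. apply sqrt_lt_R0. Qed.

Lemma continuous_speed (w : R -> R) (e s : R) :
  continuous w s -> continuous (speed w e) s.
Proof.
  intros hw; unfold speed.
  apply (continuous_comp (fun s => e + w s) sqrt).
  - apply (continuous_plus (fun _ => e) w); [apply continuous_const | exact hw].
  - apply continuous_sqrt.
Qed.

Lemma continuous_slowness (w : R -> R) (e s : R) :
  continuous w s -> 0 < e + w s -> continuous (fun s => / speed w e s) s.
Proof.
  intros hw hpos.
  apply (continuous_comp (speed w e) Rinv); [apply continuous_speed, hw|].
  apply continuity_pt_filterlim.
  apply (continuity_pt_inv id); [apply derivable_continuous_pt, derivable_pt_id|].
  apply Rgt_not_eq, speed_pos, hpos.
Qed.

Lemma ex_RInt_slowness (w : R -> R) (e a b : R) :
  a <= b ->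
  (forall s, continuous w s) -> (forall s, a <= s <= b -> 0 < e + w s) ->
  ex_RInt (fun s => / speed w e s) a b.
Proof.
  intros hab hw hpos; apply (ex_RInt_continuous (fun s => / speed w e s)).
  rewrite Rmin_left, Rmax_right by exact hab.
  intros s hs; apply continuous_slowness; auto.
Qed.

Lemma is_derive_transit (w : R -> R) (e a x : R) :
  (forall s, continuous w s) -> (forall s, 0 <= w s) -> 0 < e ->
  is_derive (fun b => transit w e a b) x (/ speed w e x).
Proof.
  intros hw hnn he.
  assert (hc : forall s, continuous (fun s => / speed w e s) s).
  { intros s; apply continuous_slowness; [apply hw | specialize (hnn s); lra]. }
  apply (is_derive_RInt (fun s => / speed w e s) _ a); [|apply hc].
  apply filter_forall; intros b.
  apply (RInt_correct (fun s => / speed w e s)).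
  apply (ex_RInt_continuous (fun s => / speed w e s)); auto.
Qed.

(** The ratio (e' + w) / (e + w) is largest where [w] is smallest, hence at most
(m + e') / (m + e) =: 1 / q with q <= 1; taking square roots gives the factor
sqrt q >= q.  The weaker factor q is enough both for the Lipschitz estimate
(m = 0, e > 0) and for comparison with e = 0 (m > 0). *)
Lemma transit_scaling (w : R -> R) (m e e' a b : R) :
  a <= b -> (forall s, continuous w s) ->
  (forall s, a <= s <= b -> m <= w s) -> 0 < m + e -> e <= e' ->
  (m + e) / (m + e') * transit w e a b <= transit w e' a b.
Proof.
  intros hab hw hm hpos hee.
  assert (hx : ex_RInt (fun s => / speed w e s) a b).
  { apply ex_RInt_slowness; auto; intros s hs; specialize (hm s hs); lra. }
  unfold transit.
  replace (_ * _) with (RInt (fun s => scal ((m + e) / (m + e')) (/ speed w e s)) a b)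
    by exact (RInt_scal (fun s => / speed w e s) a b _ hx).
  apply RInt_le; [exact hab | | |].
  - apply (ex_RInt_scal (fun s => / speed w e s)); exact hx.
  - apply ex_RInt_slowness; auto; intros s hs; specialize (hm s hs); lra.
  - intros s hs; unfold scal; simpl; unfold mult; simpl.
    specialize (hm s ltac:(lra)).
    assert (hp : 0 < speed w e s) by (apply speed_pos; lra).
    assert (hp' : 0 < speed w e' s) by (apply speed_pos; lra).
    set (q := (m + e) / (m + e')).
    assert (hq : 0 < q <= 1).
    { unfold q; split; [apply Rdiv_lt_0_compat; lra|].
      apply Rle_div_l; lra. }
    (* Cross-multiplied, this is (e' - e) (w s - m) >= 0. *)
    assert (hqw : q * (e' + w s) <= e + w s).
    { unfold q.
      replace ((m + e) / (m + e') * (e' + w s))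
        with (((m + e) * (e' + w s)) / (m + e')) by (field; lra).
      apply Rle_div_l; [lra|].
      nra. }
    (* q <= 1 gives q = sqrt (q * q) <= sqrt q. *)
    assert (hsp : q * speed w e' s <= speed w e s).
    { unfold speed; rewrite <- (sqrt_Rsqr q) by lra.
      rewrite <- sqrt_mult by (try apply Rle_0_sqr; lra).
      apply sqrt_le_1_alt; unfold Rsqr; nra. }
    apply (Rmult_le_reg_r (speed w e s * speed w e' s)); [nra|].
    replace (q * / speed w e s * (speed w e s * speed w e' s))
      with (q * speed w e' s) by (field; lra).
    replace (/ speed w e' s * (speed w e s * speed w e' s))
      with (speed w e s) by (field; lra).
    exact hsp.
Qed.

Lemma transit_decreasing (w : R -> R) (e e' a b : R) :
  a < b -> (forall s, continuous w s) -> (forall s, 0 <= w s) ->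
  0 < e -> e < e' -> transit w e' a b < transit w e a b.
Proof.
  intros hab hw hnn he hee.
  apply RInt_lt; [exact hab | | |]; intros s _; specialize (hnn s).
  - apply continuous_slowness; [apply hw | lra].
  - apply continuous_slowness; [apply hw | lra].
  - apply Rinv_lt_contravar.
    + apply Rmult_lt_0_compat; apply speed_pos; lra.
    + apply sqrt_lt_1_alt; lra.
Qed.

Lemma transit_le (w : R -> R) (e a b : R) :
  a <= b -> (forall s, continuous w s) -> (forall s, 0 <= w s) ->
  0 < e -> transit w e a b <= (b - a) / sqrt e.
Proof.
  intros hab hw hnn he.
  replace ((b - a) / sqrt e) with (RInt (fun _ => / sqrt e) a b)
    by (rewrite RInt_const; reflexivity).
  apply RInt_le; [exact hab | | apply ex_RInt_const |].
  - apply ex_RInt_slowness; auto; intros s _; specialize (hnn s); lra.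
  - intros s _; specialize (hnn s); unfold speed.
    apply Rinv_le_contravar; [apply sqrt_lt_R0, he | apply sqrt_le_1_alt; lra].
Qed.

Lemma transit_pos (w : R -> R) (e a b : R) :
  a < b -> (forall s, continuous w s) -> (forall s, 0 <= w s) ->
  0 < e -> 0 < transit w e a b.
Proof.
  intros hab hw hnn he; apply RInt_gt_0; [exact hab | |]; intros s _; specialize (hnn s).
  - apply Rinv_0_lt_compat, speed_pos; lra.
  - apply continuous_slowness; [apply hw | lra].
Qed.

Lemma transit_lipschitz (w : R -> R) (e1 e e' a b : R) :
  a < b -> (forall s, continuous w s) -> (forall s, 0 <= w s) ->
  0 < e1 -> e1 <= e -> e <= e' ->
  0 <= transit w e a b - transit w e' a b <= transit w e1 a b / e1 * (e' - e).
Proof.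
  intros hab hw hnn he1 he hee.
  assert (hmono : forall x y, 0 < x <= y -> transit w y a b <= transit w x a b).
  { intros x y [hx [hlt | ->]]; [|lra].
    apply Rlt_le, transit_decreasing; auto. }
  pose proof (transit_scaling w 0 e e' a b ltac:(lra) hw
    (fun s _ => hnn s) ltac:(lra) hee) as hsc.
  rewrite !Rplus_0_l in hsc.
  pose proof (hmono e e' ltac:(lra)).
  pose proof (hmono e1 e ltac:(lra)).
  pose proof (transit_pos w e a b hab hw hnn ltac:(lra)).
  split; [lra|].
  apply Rle_trans with (transit w e a b * ((e' - e) / e')).
  - replace (transit w e a b * ((e' - e) / e'))
      with (transit w e a b - e / e' * transit w e a b) by (field; lra).
    lra.
  - replace (transit w e1 a b / e1 * (e' - e))
      with (transit w e1 a b * ((e' - e) / e1)) by (field; lra).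
    apply Rmult_le_compat; [lra | apply Rdiv_le_0_compat; lra | lra |].
    apply Rmult_le_compat_l; [lra|].
    apply Rinv_le_contravar; lra.
Qed.

(** Intermediate values: the transit time tends to 0 as the energy grows, being at
most (b - a) / sqrt e.  Freezing the energy below [e1] makes it Lipschitz on the
whole line. *)
Lemma transit_onto (w : R -> R) (e1 a b l : R) :
  a < b -> (forall s, continuous w s) -> (forall s, 0 <= w s) ->
  0 < e1 -> 0 < l <= transit w e1 a b ->
  exists e, 0 < e /\ transit w e a b = l.
Proof.
  intros hab hw hnn he1 hl.
  set (tau := fun e => transit w (Rmax e1 e) a b).
  set (K := transit w e1 a b / e1).
  assert (hK : 0 < K) by (apply Rdiv_lt_0_compat; lra).
  assert (hlip : forall x y, x <= y -> Rabs (tau x - tau y) <= K * (y - x)).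
  { intros x y hxy; unfold tau.
    pose proof (Rmax_l e1 x); pose proof (Rmax_l e1 y).
    assert (hm : 0 <= Rmax e1 y - Rmax e1 x <= y - x).
    { unfold Rmax; destruct (Rle_dec e1 x); destruct (Rle_dec e1 y); lra. }
    destruct (transit_lipschitz w e1 (Rmax e1 x) (Rmax e1 y) a b) as [h1 h2];
      auto; [lra|].
    fold K in h2; rewrite Rabs_pos_eq by exact h1; nra. }
  assert (hcont : continuity tau).
  { intros x eps heps; exists (eps / K); split; [apply Rdiv_lt_0_compat; lra|].
    intros y [_ hy]; simpl in *; unfold R_dist in *.
    apply Rlt_div_r in hy; [|exact hK].
    destruct (Rle_or_lt x y) as [h|h].
    - rewrite Rabs_minus_sym; pose proof (hlip x y h).
      rewrite Rabs_pos_eq in hy by lra; lra.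
    - pose proof (hlip y x ltac:(lra)).
      rewrite Rabs_left in hy by lra; lra. }
  (* At energy r^2 the bound (b - a) / sqrt e equals l. *)
  set (r := (b - a) / l).
  assert (hr : 0 < r) by (apply Rdiv_lt_0_compat; lra).
  set (e2 := Rmax e1 (r * r)).
  assert (he2 : tau e2 <= l).
  { unfold tau; rewrite Rmax_right by apply Rmax_l.
    apply Rle_trans with ((b - a) / sqrt e2).
    - apply transit_le; auto; [lra | pose proof (Rmax_l e1 (r * r)); unfold e2; lra].
    - replace l with ((b - a) / r) by (unfold r; field; lra).
      apply Rmult_le_compat_l; [lra|].
      apply Rinv_le_contravar; [exact hr|].
      rewrite <- (sqrt_square r) at 1 by lra.
      apply sqrt_le_1_alt, Rmax_r. }
  assert (he1' : tau e1 = transit w e1 a b)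
    by (unfold tau; rewrite Rmax_left by lra; reflexivity).
  destruct (IVT_gen tau e1 e2 l hcont) as [e [_ he]].
  { rewrite Rmin_right, Rmax_left by lra; lra. }
  exists (Rmax e1 e); split; [pose proof (Rmax_l e1 e); lra | exact he].
Qed.

(** Mean value theorem for the transit time, written for the position as a function
of time: injectivity, and the derivative of the inverse, both follow from it. *)
Lemma transit_increment (w : R -> R) (e a x y : R) :
  (forall s, continuous w s) -> (forall s, 0 <= w s) -> 0 < e ->
  exists xi, Rmin x y <= xi <= Rmax x y /\
    y - x = speed w e xi * (transit w e a y - transit w e a x).
Proof.
  intros hw hnn he.
  destruct (MVT_gen (transit w e a) x y (fun s => / speed w e s)) as [xi [hxi heq]].
  - intros s _; apply is_derive_transit; auto.
  - intros s _; apply continuity_pt_filterlim.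
    apply (ex_derive_continuous (transit w e a)).
    exists (/ speed w e s); apply is_derive_transit; auto.
  - exists xi; split; [exact hxi|].
    rewrite heq; field.
    apply Rgt_not_eq, speed_pos; specialize (hnn xi); lra.
Qed.

Lemma transit_inj (w : R -> R) (e a x y : R) :
  (forall s, continuous w s) -> (forall s, 0 <= w s) -> 0 < e ->
  transit w e a x = transit w e a y -> x = y.
Proof.
  intros hw hnn he heq.
  destruct (transit_increment w e a x y hw hnn he) as [xi [_ h]].
  rewrite heq in h; lra.
Qed.

Lemma transit_refl (w : R -> R) (e a : R) : transit w e a a = 0.
Proof. apply (RInt_point a (fun s => / speed w e s)). Qed.

(** * Motion with prescribed speed *)

(** For times r and t the difference quotient of the inverse function is the speed at
some point between x(r) and x(t) ([transit_increment]).  As the speed is bounded,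
that point tends to x(t) when r tends to t. *)
Lemma transit_inverse_solves (w : R -> R) (M e a b c d : R) :
  a < b -> c < d ->
  (forall s, continuous w s) -> (forall s, 0 <= w s <= M) -> 0 < e ->
  transit w e a b = d - c ->
  exists x : R -> R, forall t, c <= t <= d ->
    a <= x t <= b /\ transit w e a (x t) = t - c /\
    D_in x (fun t => speed w e (x t)) (fun t => c <= t <= d) t.
Proof.
  intros hab hcd hw hM he htr.
  assert (hnn : forall s, 0 <= w s) by (intros s; apply hM).
  assert (hcont : continuity (transit w e a)).
  { intros s; apply continuity_pt_filterlim.
    apply (ex_derive_continuous (transit w e a)).
    exists (/ speed w e s); apply is_derive_transit; auto. }
  assert (hinv : forall t, {x | c <= t <= d ->
      a <= x <= b /\ transit w e a x = t - c}).
  { intros t.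
    destruct (Rle_dec c t) as [h1|h1]; [|exists 0; lra].
    destruct (Rle_dec t d) as [h2|h2]; [|exists 0; lra].
    destruct (IVT_gen (transit w e a) a b (t - c) hcont) as [x [hx heq]].
    - rewrite transit_refl, htr, Rmin_left, Rmax_right by lra; lra.
    - rewrite Rmin_left, Rmax_right in hx by lra.
      exists x; auto. }
  set (x := fun t => proj1_sig (hinv t)).
  assert (hx : forall t, c <= t <= d -> a <= x t <= b /\ transit w e a (x t) = t - c).
  { intros t; apply (proj2_sig (hinv t)). }
  exists x; intros t ht.
  destruct (hx t ht) as [hxt htt].
  split; [exact hxt | split; [exact htt|]].
  intros eps heps.
  pose proof (continuous_speed w e (x t) (hw (x t))) as hs.
  apply continuity_pt_filterlim in hs.
  destruct (hs eps heps) as [del [hdel hlim]].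
  set (K := sqrt (e + M)).
  assert (hK : 0 < K) by (apply sqrt_lt_R0; destruct (hM 0); lra).
  exists (del / K); split; [apply Rdiv_lt_0_compat; lra|].
  intros r [[hr hne] hdist]; simpl in *; unfold R_dist in *.
  destruct (hx r hr) as [hxr hrr].
  destruct (transit_increment w e a (x t) (x r) hw hnn he) as [xi [hxi heq]].
  rewrite htt, hrr in heq.
  replace (r - c - (t - c)) with (r - t) in heq by ring.
  rewrite heq.
  replace (speed w e xi * (r - t) / (r - t)) with (speed w e xi) by (field; lra).
  destruct (Req_dec xi (x t)) as [->|hne'].
  { rewrite Rminus_diag, Rabs_R0; exact heps. }
  apply hlim; split; [split; [exact I | congruence]|].
  assert (hsK : 0 < speed w e xi <= K).
  { split; [apply speed_pos; specialize (hnn xi); lra|].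
    apply sqrt_le_1_alt; specialize (hM xi); lra. }
  apply Rle_lt_trans with (Rabs (x r - x t)).
  - revert hxi; unfold Rmin, Rmax; destruct (Rle_dec (x t) (x r)); intros hxi.
    + rewrite !Rabs_pos_eq by lra; lra.
    + rewrite !Rabs_left1 by lra; lra.
  - rewrite heq, Rabs_mult, (Rabs_pos_eq (speed w e xi)) by lra.
    apply Rlt_div_r in hdist; [|exact hK].
    pose proof (Rabs_pos (r - t)); nra.
Qed.

(** By the chain rule the transit time along a motion has derivative 1. *)
Lemma solution_transit (w : R -> R) (e a c d : R) (u : R -> R) :
  (forall s, continuous w s) -> (forall s, 0 <= w s) -> 0 < e ->
  u c = a ->
  (forall t, c <= t <= d ->
    D_in u (fun t => speed w e (u t)) (fun t => c <= t <= d) t) ->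
  forall t, c <= t <= d -> transit w e a (u t) = t - c.
Proof.
  intros hw hnn he huc hu t ht.
  destruct (D_in_MVT (fun t => transit w e a (u t)) (fun _ => 1) c d c t)
    as [xi [_ heq]]; try lra.
  - intros r hr.
    apply (D_in_imp _ _ (Dgf (fun t => c <= t <= d) no_cond u)).
    { intros s hs; split; [exact hs | exact I]. }
    eapply D_in_ext; [|apply (Dcomp _ _ (fun t => speed w e (u t)) (fun s => / speed w e s) u
      (transit w e a)); [apply hu, hr|]].
    + simpl; field; apply Rgt_not_eq, speed_pos; specialize (hnn (u r)); lra.
    + apply derivable_pt_lim_D_in, is_derive_Reals, is_derive_transit; auto.
  - rewrite huc, transit_refl in heq; lra.
Qed.

(** * The pendulum *)

(** The squared speed at zero energy; the positive part is taken so that it is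
nonnegative also beyond [phi], where the difference of cosines is negative. *)
Definition gap (phi s : R) : R := Rmax 0 (cos (2 * s) - cos (2 * phi)).

Lemma gap_continuous (phi s : R) : continuous (gap phi) s.
Proof.
  apply (continuous_ext (fun s => ((cos (2 * s) - cos (2 * phi))
    + Rabs (cos (2 * s) - cos (2 * phi))) / 2)).
  - intros r; unfold gap, Rmax, Rabs.
    destruct (Rle_dec _ _); destruct (Rcase_abs _); lra.
  - assert (hc : continuous (fun s => cos (2 * s) - cos (2 * phi)) s).
    { apply (ex_derive_continuous (fun s => cos (2 * s) - cos (2 * phi))).
      auto_derive; exact I. }
    apply (continuous_mult (K := R_AbsRing) _ (fun _ => / 2));
      [|apply continuous_const].
    apply (continuous_plus (fun s => cos (2 * s) - cos (2 * phi))); [exact hc|].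
    apply (continuous_comp _ Rabs); [exact hc | apply continuous_Rabs].
Qed.

Lemma gap_bounds (phi s : R) : 0 <= gap phi s <= 2.
Proof.
  unfold gap; split; [apply Rmax_l|].
  pose proof (COS_bound (2 * s)); pose proof (COS_bound (2 * phi)).
  apply Rmax_lub; lra.
Qed.

Lemma cos_double_gap_pos (phi s : R) :
  phi < PI / 2 -> - phi < s < phi -> 0 < cos (2 * s) - cos (2 * phi).
Proof.
  intros hphi hs.
  assert (hcase : cos (2 * s) = cos (2 * Rabs s)).
  { unfold Rabs; destruct (Rcase_abs s); [|reflexivity].
    rewrite <- (cos_neg (2 * s)); f_equal; ring. }
  rewrite hcase.
  assert (0 <= Rabs s < phi).
  { split; [apply Rabs_pos | apply Rabs_def1; lra]. }
  assert (cos (2 * phi) < cos (2 * Rabs s)) by (apply cos_decreasing_1; lra).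
  lra.
Qed.

Lemma gap_eq (phi s : R) :
  phi < PI / 2 -> - phi < s <= phi -> gap phi s = cos (2 * s) - cos (2 * phi).
Proof.
  intros hphi [h1 [h2 | ->]]; unfold gap; apply Rmax_right; [|lra].
  apply Rlt_le, cos_double_gap_pos; lra.
Qed.

(** v^2 - cos 2u has derivative 2v(-sin 2u) + 2 sin(2u) v = 0, and its value is read
off at time L, where u = phi1.  Since v > 0 makes u increasing, u stays between its
boundary values, where [gap] is the difference of cosines. *)
Lemma positive_solution_energy (phi0 phi1 L : R) (u v : R -> R) :
  0 < phi0 -> phi0 < phi1 -> phi1 < PI / 2 -> 0 < L ->
  is_positive_solution phi0 phi1 L u v ->
  exists e, 0 < e /\
    forall t, - L <= t <= L ->
      - phi0 <= u t <= phi1 /\ v t = speed (gap phi1) e (u t).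
Proof.
  intros h0 h01 h1 hL [[_ [hu [hv [hu0 hu1]]]] hpos].
  set (I := fun t => - L <= t <= L) in *.
  assert (henergy : forall t, I t ->
    v t * v t - cos (2 * u t) = v L * v L - cos (2 * phi1)).
  { intros t ht.
    destruct (D_in_MVT (fun t => v t * v t - cos (2 * u t)) (fun _ => 0) (- L) L t L)
      as [xi [_ heq]]; try (unfold I in ht; lra).
    - intros r hr.
      eapply D_in_ext; [|apply Dminus; [apply Dmult; apply hv, hr|]].
      2:{ apply (D_in_imp _ _ (Dgf I no_cond u)).
          { intros s hs; split; [exact hs | exact Logic.I]. }
          apply (Dcomp _ _ v (fun s => - sin (2 * s) * 2) u (fun s => cos (2 * s)));
            [apply hu, hr|].
          apply derivable_pt_lim_D_in, is_derive_Reals.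
          auto_derive; [exact Logic.I | ring]. }
      simpl; ring.
    - rewrite hu1 in heq; lra. }
  assert (hrange : forall t, I t -> - phi0 <= u t <= phi1).
  { intros t ht; unfold I in ht.
    destruct (D_in_MVT u v (- L) L (- L) t hu) as [xi [hxi heq]]; try lra.
    destruct (D_in_MVT u v (- L) L t L hu) as [xi' [hxi' heq']]; try lra.
    assert (hp : 0 < v xi) by (apply hpos; lra).
    assert (hp' : 0 < v xi') by (apply hpos; lra).
    rewrite hu0 in heq; rewrite hu1 in heq'; split; nra. }
  assert (hvL : 0 < v L) by (apply hpos; lra).
  exists (v L * v L); split; [nra|].
  intros t ht; specialize (hrange t ht); split; [exact hrange|].
  unfold speed; rewrite gap_eq by lra.
  specialize (henergy t ht).
  rewrite <- (sqrt_square (v t)) at 1 by (apply Rlt_le, hpos, ht).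
  f_equal; lra.
Qed.

(** Either the zero-energy integrals from -phi0 to b < phi1 all stay below [l], and
then so does T(phi1) + T1(phi1, phi0), or one of them exceeds [l].  In the latter
case the integrand is bounded on [-phi0, b], and a small positive energy changes the
integral by a factor close to 1. *)
Lemma transit_exceeds (phi0 phi1 l : R) :
  0 < phi0 -> phi0 < phi1 -> phi1 < PI / 2 ->
  l < T phi1 + T1 phi1 phi0 ->
  exists e, 0 < e /\ l < transit (gap phi1) e (- phi0) phi1.
Proof.
  intros h0 h01 h1 hl.
  set (f := fun x => / sqrt (cos (2 * x) - cos (2 * phi1))).
  assert (hfc : forall x, - phi1 < x < phi1 -> continuous f x).
  { intros x hx; unfold f.
    pose proof (cos_double_gap_pos phi1 x h1 hx).
    apply (ex_derive_continuous (fun x => / sqrt (cos (2 * x) - cos (2 * phi1)))).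
    auto_derive.
    split; [lra | split; [|exact I]].
    apply Rgt_not_eq, sqrt_lt_R0; lra. }
  assert (hfp : forall x, - phi1 < x < phi1 -> 0 <= f x).
  { intros x hx; unfold f.
    pose proof (cos_double_gap_pos phi1 x h1 hx).
    apply Rlt_le, Rinv_0_lt_compat, sqrt_lt_R0; lra. }
  assert (hex : forall a b, - phi1 < a <= b -> b < phi1 -> ex_RInt f a b).
  { intros a b ha hb; apply (ex_RInt_continuous f).
    rewrite Rmin_left, Rmax_right by lra; intros z hz; apply hfc; lra. }
  assert (hT1 : T1 phi1 phi0 <= RInt f 0 phi0).
  { apply (RInt_gen_at_left_le f); [exact h0 | | |].
    - intros x hx; apply hfc; lra.
    - intros x hx; apply hfp; lra.
    - intros b hb.
      rewrite <- (RInt_Chasles f 0 b phi0) by (apply hex; lra).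
      assert (0 <= RInt f b phi0).
      { apply RInt_ge_0; [lra | apply hex; lra | intros x hx; apply hfp; lra]. }
      unfold plus; simpl; lra. }
  assert (heven : RInt f (- phi0) 0 = RInt f 0 phi0).
  { pose proof (RInt_comp_lin f (-1) 0 0 phi0) as hlin.
    replace (-1 * 0 + 0) with 0 in hlin by ring.
    replace (-1 * phi0 + 0) with (- phi0) in hlin by ring.
    rewrite <- (opp_RInt_swap f 0 (- phi0)).
    2:{ apply ex_RInt_swap, hex; lra. }
    rewrite <- hlin by (apply ex_RInt_swap, hex; lra).
    rewrite <- RInt_opp.
    - apply RInt_ext; intros x _; unfold opp, scal; simpl; unfold mult; simpl.
      unfold f; replace (2 * (-1 * x + 0)) with (- (2 * x)) by ring.
      rewrite cos_neg; ring.
    - apply (ex_RInt_comp_lin f).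
      replace (-1 * 0 + 0) with 0 by ring.
      replace (-1 * phi0 + 0) with (- phi0) by ring.
      apply ex_RInt_swap, hex; lra. }
  assert (hb : exists b, 0 <= b < phi1 /\ l < RInt f (- phi0) b).
  { destruct (Classical_Prop.classic
      (exists b, 0 <= b < phi1 /\ l < RInt f (- phi0) b)) as [h|h]; [exact h|].
    exfalso.
    assert (hT : T phi1 <= l - RInt f 0 phi0).
    { apply (RInt_gen_at_left_le f); [lra | | |].
      - intros x hx; apply hfc; lra.
      - intros x hx; apply hfp; lra.
      - intros b hb; apply Rnot_lt_le; intros hlt; apply h.
        exists b; split; [exact hb|].
        rewrite <- (RInt_Chasles f (- phi0) 0 b) by (apply hex; lra).
        unfold plus; simpl; lra. }
    lra. }
  destruct hb as [b [hb hlb]].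
  assert (hgc : forall s, continuous (gap phi1) s) by (intros s; apply gap_continuous).
  assert (hgf : RInt f (- phi0) b = transit (gap phi1) 0 (- phi0) b).
  { apply RInt_ext; rewrite Rmin_left, Rmax_right by lra.
    intros x hx; unfold f, speed; rewrite Rplus_0_l, gap_eq by lra; reflexivity. }
  destruct (continuity_ab_min (gap phi1) (- phi0) b) as [x0 [hmin hx0]]; [lra | |].
  { intros s _; apply continuity_pt_filterlim, hgc. }
  set (m := gap phi1 x0).
  assert (hm : 0 < m).
  { unfold m; rewrite gap_eq by lra; apply cos_double_gap_pos; lra. }
  set (J := transit (gap phi1) 0 (- phi0) b) in *.
  assert (hJ : 0 <= J).
  { rewrite <- hgf; apply RInt_ge_0; [lra | apply hex; lra|].
    intros x hx; apply hfp; lra. }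
  rewrite hgf in hlb.
  (* m / (m + e) * J > l amounts to l * e < m * (J - l); as l may be negative, e is
     chosen through |l| + 1. *)
  assert (he : exists e, 0 < e /\ l * (m + e) < m * J).
  { exists (m * (J - l) / (2 * (Rabs l + 1))).
    pose proof (Rabs_pos l); pose proof (Rle_abs l).
    split; [apply Rdiv_lt_0_compat; nra|].
    set (q := m * (J - l) / (2 * (Rabs l + 1))).
    assert (hq : q * (2 * (Rabs l + 1)) = m * (J - l)) by (unfold q; field; lra).
    assert (0 < m * (J - l)) by nra.
    assert (0 < q) by (apply Rdiv_lt_0_compat; nra).
    nra. }
  destruct he as [e [he hle]].
  exists e; split; [exact he|].
  pose proof (transit_scaling (gap phi1) m 0 e (- phi0) b ltac:(lra) hgc hmin
    ltac:(lra) ltac:(lra)) as hsc.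
  fold J in hsc.
  apply Rlt_le_trans with ((m + 0) / (m + e) * J).
  { replace ((m + 0) / (m + e) * J) with ((m * J) / (m + e)) by (field; lra).
    apply Rlt_div_r; lra. }
  apply (Rle_trans _ _ _ hsc).
  assert (hx : forall a c, a <= c -> ex_RInt (fun s => / speed (gap phi1) e s) a c).
  { intros a c hac; apply ex_RInt_slowness; auto.
    intros s _; pose proof (gap_bounds phi1 s); lra. }
  unfold transit.
  rewrite <- (RInt_Chasles _ (- phi0) b phi1) by (apply hx; lra).
  assert (0 <= RInt (fun s => / speed (gap phi1) e s) b phi1).
  { apply RInt_ge_0; [lra | apply hx; lra|].
    intros s _; apply Rlt_le, Rinv_0_lt_compat, speed_pos.
    pose proof (gap_bounds phi1 s); lra. }
  unfold plus; simpl; lra.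
Qed.

Theorem mainTheorem1 (phi0 phi1 L : R)
  (hphi0 : 0 < phi0) (hphi01 : phi0 < phi1) (hphi1 : phi1 < PI / 2)
  (hL : 0 < L) (hLT : L < / 2 * (T phi1 + T1 phi1 phi0)) :
  exists x y : R -> R,
    is_positive_solution phi0 phi1 L x y /\
    (forall u v : R -> R,
       is_positive_solution phi0 phi1 L u v ->
       forall t, - L <= t <= L -> u t = x t /\ v t = y t).
Proof.
  assert (hgc : forall s, continuous (gap phi1) s) by (intros s; apply gap_continuous).
  assert (hgn : forall s, 0 <= gap phi1 s) by (intros s; apply gap_bounds).
  destruct (transit_exceeds phi0 phi1 (2 * L)) as [e1 [he1 hlt]]; try lra.
  destruct (transit_onto (gap phi1) e1 (- phi0) phi1 (2 * L)) as [e [he htr]];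
    auto; try lra.
  destruct (transit_inverse_solves (gap phi1) 2 e (- phi0) phi1 (- L) L)
    as [x hx]; auto; try lra.
  { apply gap_bounds. }
  exists x, (fun t => speed (gap phi1) e (x t)); split.
  - split; [split; [|split; [|split; [|split]]]|].
    + intros t ht; destruct (hx t ht); lra.
    + intros t ht; apply hx, ht.
    + intros t ht.
      destruct (hx t ht) as [hxt [_ hD]].
      set (h := fun s => sqrt (e + (cos (2 * s) - cos (2 * phi1)))).
      assert (hh : forall r, - L <= r <= L -> h (x r) = speed (gap phi1) e (x r)).
      { intros r hr; destruct (hx r hr) as [hxr _].
        unfold h, speed; rewrite gap_eq by lra; reflexivity. }
      assert (hpos : 0 < speed (gap phi1) e (x t)).
      { apply speed_pos; specialize (hgn (x t)); lra. }
      assert (hrad : 0 < e + (cos (2 * x t) - cos (2 * phi1))).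
      { rewrite <- gap_eq by lra; specialize (hgn (x t)); lra. }
      (* [gap] is not differentiable at phi1 = x(L), whereas [h] is; the two agree along
         x, and the relative derivative only sees values on [-L, L]. *)
      assert (hDh : D_in (fun r => h (x r)) (fun r => - sin (2 * x r))
                         (fun t => - L <= t <= L) t).
      { apply (D_in_imp _ _ (Dgf (fun t => - L <= t <= L) no_cond x)).
        { intros s hs; split; [exact hs | exact I]. }
        eapply D_in_ext; [|apply (Dcomp _ _ (fun t => speed (gap phi1) e (x t))
          (fun s => - sin (2 * s) / h s) x h); [exact hD|]].
        - simpl; rewrite hh by exact ht; field; lra.
        - apply derivable_pt_lim_D_in, is_derive_Reals; unfold h.
          auto_derive; [exact hrad|].
          change (2 * 1 * - sin (2 * x t) * / (2 * h (x t))
                  = - sin (2 * x t) / h (x t)).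
          rewrite hh by exact ht; field; lra. }
      revert hDh; apply limit1_ext.
      intros r [hr _]; rewrite !hh by assumption; reflexivity.
    + destruct (hx (- L) ltac:(lra)) as [_ [h _]].
      apply (transit_inj (gap phi1) e (- phi0)); auto.
      rewrite h, transit_refl; ring.
    + destruct (hx L ltac:(lra)) as [_ [h _]].
      apply (transit_inj (gap phi1) e (- phi0)); auto.
      rewrite h, htr; ring.
    + intros t ht; apply speed_pos; specialize (hgn (x t)); lra.
  - intros u v huv.
    destruct (positive_solution_energy phi0 phi1 L u v hphi0 hphi01 hphi1 hL huv)
      as [e' [he' huse]].
    destruct huv as [[_ [hu [_ [hu0 hu1]]]] _].
    assert (htu : forall t, - L <= t <= L ->
      transit (gap phi1) e' (- phi0) (u t) = t - - L).
    { apply (solution_transit (gap phi1) e' (- phi0) (- L) L u); auto.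
      intros t ht; apply (D_in_ext v _ u); [apply huse, ht | apply hu, ht]. }
    assert (hee : e' = e).
    { pose proof (htu L ltac:(lra)) as hend; rewrite hu1 in hend.
      destruct (Rtotal_order e' e) as [h | [h | h]]; [exfalso | exact h | exfalso].
      - pose proof (transit_decreasing (gap phi1) e' e (- phi0) phi1
          ltac:(lra) hgc hgn he' h); lra.
      - pose proof (transit_decreasing (gap phi1) e e' (- phi0) phi1
          ltac:(lra) hgc hgn he h); lra. }
    subst e'.
    intros t ht.
    assert (hux : u t = x t).
    { apply (transit_inj (gap phi1) e (- phi0)); auto.
      rewrite htu by exact ht; symmetry; apply hx, ht. }
    split; [exact hux|].
    rewrite <- hux; apply huse, ht.
Qed.
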